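(* Let $R$ be a unital ring. Then $\overrightarrow{\Gamma}_{E}(R)=\overrightarrow{\Gamma}(R)$ if and only if the following two conditions hold. (1) $x^{2}=0$ for all $x\in\mathrm{Nil}(R)$. (2) $\mathrm{Ann}_{l}(y^{2})=\mathrm{Ann}_{l}(y)$ and $\mathrm{Ann}_{r}(y^{2})=\mathrm{Ann}_{r}(y)$ for all $y\in Z(R)\setminus\mathrm{Nil}(R)$.
   Context: Rings are associative and not necessarily commutative; for $A\subseteq R$, $A^{*}=A\setminus\{0\}$. An element $x\in R$ is a left (resp. right) zero divisor if $xy=0$ (resp. $yx=0$) for some $y\in R^{*}$; $Z(R)$ is the set of all elements that are left or right zero divisors. $\mathrm{Nil}(R)$ is the set of nilpotent elements of $R$. For $x\in R$, $\mathrm{Ann}_{l}(x)=\{s\in R: sx=0\}$ and $\mathrm{Ann}_{r}(x)=\{s\in R: xs=0\}$. All digraphs are simple (no loops, no multiple arcs). The zero-divisor digraph $\overrightarrow{\Gamma}(R)$ has vertex set $Z(R)^{*}$, and for distinct $x,y\in Z(R)^{*}$, $x\to y$ is an arc if and only if $xy=0$. The extended zero-divisor digraph $\overrightarrow{\Gamma}_{E}(R)$ has the same vertex set, and for distinct $x,y\in Z(R)^{*}$, $x\to y$ is an arc if and only if $x^{n}y^{m}=0$ for some positive integers $n,m$ with $x^{n}\neq 0$ and $y^{m}\neq 0$. Equality of these digraphs means equality of arc sets. *)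

(* Defs.v *)
From mathcomp Require Import all_boot all_algebra.
From mathcomp Require Import classical_sets.

Set Implicit Arguments.
Unset Strict Implicit.
Unset Printing Implicit Defensive.

Import GRing.Theory.

Local Open Scope classical_set_scope.
Local Open Scope ring_scope.

Record digraph (T : Type) := Digraph {
  vertices : set T;
  arcs : set (T * T)
}.

Definition left_zero_divisor (R : pzRingType) (x : R) : Prop :=
  exists y : R, y <> 0 /\ x * y = 0.

Definition right_zero_divisor (R : pzRingType) (x : R) : Prop :=
  exists y : R, y <> 0 /\ y * x = 0.

(* Contains 0 exactly when R is not the zero ring. *)
Definition zero_divisors (R : pzRingType) : set R :=
  [set x | left_zero_divisor x \/ right_zero_divisor x].
Arguments zero_divisors R : clear implicits.

Definition nonzero (R : pzRingType) (A : set R) : set R := A `\` [set 0].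

Definition nilpotents (R : pzRingType) : set R :=
  [set x | exists n : nat, (0 < n)%N /\ x ^+ n = 0].
Arguments nilpotents R : clear implicits.

Definition ann_l (R : pzRingType) (x : R) : set R := [set s | s * x = 0].

Definition ann_r (R : pzRingType) (x : R) : set R := [set s | x * s = 0].

Definition zero_divisor_digraph (R : pzRingType) : digraph R := {|
  vertices := nonzero (zero_divisors R);
  arcs := [set p | [/\ nonzero (zero_divisors R) p.1,
                       nonzero (zero_divisors R) p.2,
                       p.1 <> p.2 & p.1 * p.2 = 0]]
|}.
Arguments zero_divisor_digraph R : clear implicits.

Definition extended_zero_divisor_digraph (R : pzRingType) : digraph R := {|
  vertices := nonzero (zero_divisors R);
  arcs := [set p | [/\ nonzero (zero_divisors R) p.1,
                       nonzero (zero_divisors R) p.2,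
                       p.1 <> p.2 &
                       exists n m : nat,
                         [/\ (0 < n)%N, (0 < m)%N, p.1 ^+ n * p.2 ^+ m = 0,
                             p.1 ^+ n <> 0 & p.2 ^+ m <> 0]]]
|}.
Arguments extended_zero_divisor_digraph R : clear implicits.

(* Main.v *)
Require Import Defs.
From mathcomp Require Import all_boot all_algebra.
From mathcomp Require Import classical_sets.

Set Implicit Arguments.
Unset Strict Implicit.
Unset Printing Implicit Defensive.

Import GRing.Theory.

Local Open Scope classical_set_scope.
Local Open Scope ring_scope.

(** Taking n = m = 1 shows that every arc of the zero-divisor digraph is an
arc of the extended one, so equality means that, for distinct zero divisors,
x ^+ n * y ^+ m = 0 with nonzero powers forces x * y = 0 ([eq_arcsP]).

Suppose that nilpotents square to zero and that the other zero divisors have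
the same annihilators as their squares.  Then the exponents can be removed
from each factor separately ([expr_annihilation]): a nonzero positive power of
a nilpotent x is x itself, because x ^+ 2 = 0, while for a non-nilpotent zero
divisor the annihilators of x ^+ n and of x agree ([ann_r_expr],
[ann_l_expr]).

Conversely, suppose that the digraphs are equal.  If x is nilpotent of index
k >= 3, the relation x ^+ k.-1 * x = 0 would give an arc from x to itself, and
loops are excluded.  The perturbation y = x + x ^+ k.-1 avoids the loop and
behaves like x: x ^+ k.-1 * y = 0, whereas x * y = x ^+ 2 <> 0
([nilpotent_sqr0]).  If y is a non-nilpotent zero divisor and s * y ^+ 2 = 0
with s <> 0, then s <> y, since otherwise y ^+ 3 = 0; hence s -> y is an arc
of the extended digraph and s * y = 0.  The right annihilator is treated in
the same way. *)

Lemma eq_arcsP (R : pzRingType) :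
  arcs (extended_zero_divisor_digraph R) = arcs (zero_divisor_digraph R)
  <->
  (forall (x y : R) n m,
     zero_divisors R x -> zero_divisors R y -> x <> y ->
     (0 < n)%N -> (0 < m)%N ->
     x ^+ n * y ^+ m = 0 -> x ^+ n <> 0 -> y ^+ m <> 0 -> x * y = 0).
Proof.
split=> [eqE x y n m Zx Zy xy n0 m0 xnym0 xn0 ym0 | collapse].
  have base_neq0 (z : R) k : (0 < k)%N -> z ^+ k <> 0 -> z <> 0.
    by move=> k0 zk0 z0; apply: zk0; rewrite z0 expr0n eqn0Ngt k0.
  have : arcs (extended_zero_divisor_digraph R) (x, y).
    split=> //=; last by exists n, m.
      by split=> //; exact: base_neq0 xn0.
    by split=> //; exact: base_neq0 ym0.
  by rewrite eqE => -[].
apply/seteqP; split=> -[x y] [/= Zx Zy xy].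
  move=> [n [m [n0 m0 xnym0 xn0 ym0]]]; split=> //=.
  by apply: collapse xnym0 xn0 ym0 => //; [case: Zx | case: Zy].
move=> xy0; split=> //=; exists 1%N, 1%N.
by rewrite !expr1; split=> //; [case: Zx | case: Zy].
Qed.

(** Each use of the hypothesis lowers the exponent by one, by splitting
x ^+ n.+2 as x ^+ 2 times a power of x. *)
Lemma ann_r_expr (R : pzRingType) (x : R) n :
  ann_r (x ^+ 2) = ann_r x -> (0 < n)%N -> ann_r (x ^+ n) `<=` ann_r x.
Proof.
move=> ann_x2; case: n => // n _ s; rewrite /ann_r /=.
elim: n => [|n IHn] xs0; first by rewrite expr1 in xs0.
apply: IHn; rewrite exprS -mulrA.
have : ann_r (x ^+ 2) (x ^+ n * s) by rewrite /ann_r /= mulrA -exprD.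
by rewrite ann_x2.
Qed.

Lemma ann_l_expr (R : pzRingType) (x : R) n :
  ann_l (x ^+ 2) = ann_l x -> (0 < n)%N -> ann_l (x ^+ n) `<=` ann_l x.
Proof.
move=> ann_x2; case: n => // n _ s; rewrite /ann_l /=.
elim: n => [|n IHn] xs0; first by rewrite expr1 in xs0.
apply: IHn; rewrite exprSr mulrA.
have : ann_l (x ^+ 2) (s * x ^+ n) by rewrite /ann_l /= -mulrA -exprD addn2.
by rewrite ann_x2.
Qed.

Lemma nilpotent_sqr0 (R : pzRingType) (x : R) :
  arcs (extended_zero_divisor_digraph R) = arcs (zero_divisor_digraph R) ->
  nilpotents R x -> x ^+ 2 = 0.
Proof.
move=> /eq_arcsP collapse [n [_ xn0]].
have : exists k, x ^+ k == 0 by exists n; apply/eqP.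
case/ex_minnP=> k /eqP xk0 min_k.
have exprx_ge j : (k <= j)%N -> x ^+ j = 0.
  by move=> /subnKC <-; rewrite exprD xk0 mul0r.
case: (leqP k 2) => [/exprx_ge // | k_gt2].
(* From here on the index of nilpotency is k.+1. *)
case: k k_gt2 xk0 min_k exprx_ge => // k k_gt1 xk0 min_k exprx_ge.
have xk_neq0 : x ^+ k <> 0 by move=> /eqP/min_k; rewrite ltnn.
set y := x + x ^+ k.
have xky0 : x ^+ k * y = 0.
  rewrite mulrDr -exprSr -exprD xk0 add0r; apply: exprx_ge.
  by rewrite -addn1 leq_add2l ltnW.
have xy : x * y = x ^+ 2 by rewrite mulrDr -expr2 -exprS xk0 addr0.
have [y0 | /eqP y_neq0] := eqVneq y 0; first by rewrite -xy y0 mulr0.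
rewrite -xy; have k_gt0 : (0 < k)%N by exact: ltnW.
have Zx : zero_divisors R x by left; exists (x ^+ k); rewrite -exprS.
have Zy : zero_divisors R y by right; exists (x ^+ k).
have x_neq_y : x <> y.
  by move=> /esym/eqP; rewrite -subr_eq0 addrAC subrr add0r => /eqP.
exact: (collapse x y k 1%N Zx Zy x_neq_y k_gt0 isT xky0 xk_neq0 y_neq0).
Qed.

(** When x is nilpotent, only the exponent 1 gives a nonzero power, so both
conditions lead to the same cancellation of the exponent. *)
Lemma expr_annihilation (R : pzRingType) (x : R) n :
  (nilpotents R x -> x ^+ 2 = 0) ->
  (~ nilpotents R x ->
     ann_l (x ^+ 2) = ann_l x /\ ann_r (x ^+ 2) = ann_r x) ->
  (0 < n)%N -> x ^+ n <> 0 ->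
  ann_l (x ^+ n) `<=` ann_l x /\ ann_r (x ^+ n) `<=` ann_r x.
Proof.
move=> nil_x ann_x n0 xn0.
have [/nil_x x2 | /ann_x [al ar]] := boolp.EM (nilpotents R x); last first.
  by split; [exact: ann_l_expr | exact: ann_r_expr].
case: n n0 xn0 => [|[|n]] // _; first by rewrite expr1; split=> s.
by case; rewrite -addn2 exprD x2 mulr0.
Qed.

Theorem theorem6p1 (R : pzRingType) :
  arcs (extended_zero_divisor_digraph R) = arcs (zero_divisor_digraph R)
  <->
  (forall x : R, nilpotents R x -> x ^+ 2 = 0) /\
  (forall y : R, (zero_divisors R `\` nilpotents R) y ->
     ann_l (y ^+ 2) = ann_l y /\ ann_r (y ^+ 2) = ann_r y).
Proof.
split=> [eqE | [nil2 ann2]].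
  split=> [x | y [Zy nNy]]; first exact: nilpotent_sqr0.
  have y2_neq0 : y ^+ 2 <> 0 by move=> y20; apply: nNy; exists 2%N.
  have y3_neq0 : y ^+ 3 <> 0 by move=> y30; apply: nNy; exists 3%N.
  move/eq_arcsP: eqE => collapse.
  split; apply/seteqP; split=> s; rewrite /ann_l /ann_r /= => sy0.
  - have [-> | /eqP s0] := eqVneq s 0; first by rewrite mul0r.
    apply: (collapse s y 1%N 2%N); rewrite ?expr1 //.
      by left; exists (y ^+ 2).
    by move=> sy; apply: y3_neq0; rewrite exprS -{1}sy.
  - by rewrite expr2 mulrA sy0 mul0r.
  - have [-> | /eqP s0] := eqVneq s 0; first by rewrite mulr0.
    apply: (collapse y s 2%N 1%N); rewrite ?expr1 //.
      by right; exists (y ^+ 2).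
    by move=> ys; apply: y3_neq0; rewrite exprSr {2}ys.
  - by rewrite expr2 -mulrA sy0 mulr0.
apply/eq_arcsP => x y n m Zx Zy _ n0 m0 xnym0 xn0 ym0.
have [_ arx] := expr_annihilation (nil2 x) (fun h => ann2 x (conj Zx h)) n0 xn0.
have [aly _] := expr_annihilation (nil2 y) (fun h => ann2 y (conj Zy h)) m0 ym0.
by apply: aly; apply: arx.
Qed.
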